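(* Let $(u_n)_{n\ge 0}$ be a strictly increasing sequence of positive integers, and let $s_n = u_{n+1}-u_n-1$ denote the size of the $n$-th gap. The three Pythagorean mean-based gap-sums are: (i) Arithmetic: $GS_n^{(A)} = \dfrac{s_n}{2}(u_n+u_{n+1})$; (ii) Geometric: $GS_n^{(G)} = \log\!\left(\dfrac{(u_{n+1}-1)!}{u_n!}\right)$; (iii) Harmonic: $GS_n^{(H)} = H_{u_{n+1}-1} - H_{u_n}$, where $H_k = \sum_{i=1}^{k}\frac1i$ is the $k$-th harmonic number. Moreover, all three satisfy the unified formula $$GS_n^{(f)} = s_n \cdot f\bigl(M_f(\mathrm{gap})\bigr),$$ or equivalently, in words, $GS_n^{(\mathrm{mean})} = (\text{gap size}) \times (\text{the transformed quasi-arithmetic mean})$, where $M_f(\mathrm{gap})$ is the quasi-arithmetic mean of the gap elements $\{u_n+1,\ldots,u_{n+1}-1\}$ with respect to $f$.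
   Context: The gap-sums are defined by $GS_n^{(A)} = \sum_{i=u_n+1}^{u_{n+1}-1} i$ (arithmetic), $GS_n^{(G)} = \sum_{i=u_n+1}^{u_{n+1}-1}\log(i)$ (geometric), and $GS_n^{(H)} = \sum_{i=u_n+1}^{u_{n+1}-1}\frac1i$ (harmonic). They are the sums $GS_n^{(f)} = \sum_{i=u_n+1}^{u_{n+1}-1} f(i)$ for $f(x)=x$, $f(x)=\log(x)$ and $f(x)=1/x$ respectively. For a strictly monotonic differentiable function $f\colon\mathbb{R}^+\to\mathbb{R}$, the quasi-arithmetic mean of elements $a_1,\dots,a_m$ with respect to $f$ is $M_f(a_1,\dots,a_m) = f^{-1}\!\left(\frac1m\sum_{i=1}^m f(a_i)\right)$; the arithmetic, geometric and harmonic means correspond to $f(x)=x$, $f(x)=\log(x)$ and $f(x)=1/x$. *)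

(* Defs.v *)
From HB Require Import structures.
From mathcomp Require Import all_boot all_order all_algebra.
From mathcomp Require Import all_classical all_reals all_analysis.

Set Implicit Arguments.
Unset Strict Implicit.
Unset Printing Implicit Defensive.

Import Order.TTheory GRing.Theory Num.Theory.

Local Open Scope classical_set_scope.
Local Open Scope ring_scope.

(* The subtraction is truncated, but no truncation takes place when [u] is
   strictly increasing. *)
Definition gap_size (u : nat -> nat) (n : nat) : nat := (u n.+1 - u n - 1)%N.

(* The bounds of [index_iota] and of the sum range [a <= i < b] are
   half-open: both run over u_n + 1, ..., u_(n+1) - 1. *)
Definition gap (R : realType) (u : nat -> nat) (n : nat) : seq R :=
  [seq i%:R | i <- index_iota (u n).+1 (u n.+1)].

Definition gap_sum (R : realType) (f : R -> R) (u : nat -> nat) (n : nat) : R :=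
  \sum_((u n).+1 <= i < u n.+1) f i%:R.

(* f^-1 is the inverse of f as a function on the positive reals: ['pinv_d D f y]
   is a preimage of y lying in D whenever y belongs to f @` D, and it is the
   preimage when f is injective on D.  The mean of the empty sequence is a
   junk value. *)
Definition quasi_arith_mean (R : realType) (f : R -> R) (a : seq R) : R :=
  'pinv_(fun=> 0) [set x : R | 0 < x] f ((size a)%:R^-1 * \sum_(x <- a) f x).

Definition harmonic_number (R : realType) (k : nat) : R :=
  \sum_(1 <= i < k.+1) i%:R^-1.

(* Main.v *)
Require Import Defs.
From mathcomp Require Import all_boot all_order all_algebra.
From mathcomp Require Import all_classical all_reals all_analysis.
From mathcomp Require Import ring.

Import Order.TTheory GRing.Theory Num.Theory.
Import numFieldNormedType.Exports.

Local Open Scope ring_scope.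

(** Closed forms: each of the three summands is a difference f(k+1) = F(k+1) - F(k),
    with F(k) equal to k(k+1)/2, to the logarithm of k!, and to H_k respectively,
    so that each gap-sum telescopes ([gap_sum_telescope]) to F(u_(n+1) - 1) - F(u_n).

    Unified formula: by definition the gap-sum is the number of summands times
    the average of f over the gap, so all that is needed is that applying f to the
    quasi-arithmetic mean gives back this average.  The mean is a chosen preimage,
    so this amounts to the average being a value of f on the positive reals.
    It is one by the intermediate value theorem, as it lies between two values
    of f on the gap and f is continuous ([quasi_arith_meanK]).  An empty gap, for
    which the mean is arbitrary, makes both sides zero. *)

Lemma gap_sum_telescope (R : realType) (f : R -> R) (F : nat -> R)
    (u : nat -> nat) (n : nat) :
  (u n < u n.+1)%N -> (forall k, F k.+1 - F k = f k.+1%:R) ->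
  gap_sum f u n = F (u n.+1 - 1)%N - F (u n).
Proof.
rewrite /gap_sum; case: (u n.+1) => [//|m]; rewrite ltnS subn1 /= => le_um dF.
rewrite -telescope_sumr// big_add1 /=.
by apply: eq_bigr => k _; rewrite dF.
Qed.

(** Otherwise summing the strict inequalities over the sequence would make the
    sum exceed itself. *)
Lemma exists_le_average (R : realType) (f : R -> R) (a : seq R) :
  (0 < size a)%N ->
  exists2 x, x \in a & f x <= (size a)%:R^-1 * \sum_(x <- a) f x.
Proof.
move=> a_gt0; set v := _ * _.
have [/hasP[x]|/hasPn gtv] := boolP (has (fun x => f x <= v) a); first by exists x.
have : \sum_(x <- a) v < \sum_(x <- a) f x.
  rewrite big_seq_cond [ltRHS]big_seq_cond; apply: ltr_sum.
    by case: a a_gt0 {v gtv} => //= x a _; rewrite inE eqxx.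
  by move=> x /andP[/gtv]; rewrite -ltNge.
by rewrite big_const_seq count_predT iter_addr_0 -mulr_natl mulVKf ?ltxx// pnatr_eq0 -lt0n.
Qed.

Lemma exists_ge_average (R : realType) (f : R -> R) (a : seq R) :
  (0 < size a)%N ->
  exists2 x, x \in a & (size a)%:R^-1 * \sum_(x <- a) f x <= f x.
Proof.
move=> /(exists_le_average R (fun x => - f x))[x xa].
by rewrite sumrN mulrN lerN2; exists x.
Qed.

(** The chosen preimage is a genuine one as soon as the average is a value of f
    on the positive reals.  The two sequence elements whose values surround the
    average may come in either order, whence the intermediate value theorem on
    an interval with arbitrary positive endpoints. *)
Lemma quasi_arith_meanK (R : realType) (f : R -> R) (a : seq R) :
  (forall x : R, 0 < x -> {for x, continuous f}) ->
  (0 < size a)%N -> {in a, forall x, 0 < x} ->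
  f (quasi_arith_mean f a) = (size a)%:R^-1 * \sum_(x <- a) f x.
Proof.
move=> fc a_gt0 a_pos; rewrite /quasi_arith_mean; set v := _ * _.
suff [c c_gt0 fcv] : exists2 c, 0 < c & f c = v.
  by apply: pinvK; rewrite inE; exists c.
have [x xa fxv] := exists_le_average R f a a_gt0.
have [y ya fyv] := exists_ge_average R f a a_gt0.
rewrite -/v in fxv fyv.
have ivt s t : 0 < s -> s <= t -> Num.min (f s) (f t) <= v <= Num.max (f s) (f t) ->
    exists2 c, 0 < c & f c = v.
  move=> s_gt0 st vst; have [|c] := IVT st _ vst; last first.
    by rewrite in_itv /= => /andP[sc _]; exists c => //; apply: lt_le_trans sc.
  apply: continuous_in_subspaceT => z; rewrite inE /= in_itv /= => /andP[sz _].
  exact/fc/(lt_le_trans s_gt0).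
have [xy|/ltW yx] := leP x y.
  by apply: (ivt x y) => //; [exact: a_pos|rewrite ge_min le_max fxv fyv orbT].
by apply: (ivt y x) => //; [exact: a_pos|rewrite ge_min le_max fxv fyv orbT].
Qed.

Lemma size_gap (R : realType) (u : nat -> nat) (n : nat) :
  size (gap R u n) = gap_size u n.
Proof. by rewrite size_map size_iota /gap_size subnS subn1. Qed.

Lemma gap_sum_eq_size_mean (R : realType) (f : R -> R) (u : nat -> nat) (n : nat) :
  (forall x : R, 0 < x -> {for x, continuous f}) ->
  gap_sum f u n = (gap_size u n)%:R * f (quasi_arith_mean f (gap R u n)).
Proof.
move=> fc; have sumE : gap_sum f u n = \sum_(x <- gap R u n) f x by rewrite big_map.
rewrite sumE -(size_gap R); have [|gap_gt0] := posnP (size (gap R u n)).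
  by move=> s0; rewrite s0 mul0r (size0nil s0) big_nil.
rewrite quasi_arith_meanK ?mulVKf// ?pnatr_eq0 -?lt0n//.
move=> x /mapP[i]; rewrite mem_index_iota => /andP[ui _] ->.
by rewrite ltr0n (leq_ltn_trans _ ui).
Qed.

Theorem mainTheorem2 (R : realType) (u : nat -> nat)
    (u_gt0 : forall n : nat, (0 < u n)%N)
    (u_incr : {homo u : m n / (m < n)%N}) (n : nat) :
  [/\ gap_sum (fun x : R => x) u n
        = (gap_size u n)%:R / 2 * ((u n)%:R + (u n.+1)%:R),
      gap_sum (fun x : R => ln x) u n
        = ln (((u n.+1 - 1)`!)%:R / ((u n)`!)%:R)
    & gap_sum (fun x : R => x^-1) u n
        = harmonic_number R (u n.+1 - 1) - harmonic_number R (u n)]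
  /\
  (let unified (f : R -> R) :=
     gap_sum f u n
       = (gap_size u n)%:R * f (quasi_arith_mean f (gap R u n)) in
   [/\ unified (fun x : R => x),
       unified (fun x : R => ln x)
     & unified (fun x : R => x^-1)]).
Proof.
have lt_u : (u n < u n.+1)%N by apply: u_incr.
have fact_pos k : (k`!)%:R \in @Num.pos R by rewrite posrE ltr0n fact_gt0.
split; last first.
  split; apply: gap_sum_eq_size_mean => x x_gt0.
  - exact: cvg_id.
  - exact: continuous_ln.
  - by apply: inv_continuous; rewrite gt_eqF.
split.
- rewrite (gap_sum_telescope R _ (fun k => k%:R * (k%:R + 1) / 2))//; last first.
    by move=> k; rewrite -natr1; field.
  rewrite /gap_size; case: (u n.+1) lt_u => [//|m]; rewrite ltnS => le_um.
  by rewrite subnAC !subn1 /= natrB// -(natr1 m); field.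
- rewrite (gap_sum_telescope R _ (fun k => ln (k`!)%:R)) ?ln_div// => k.
  by rewrite -ln_div// factS natrM mulfK// pnatr_eq0 -lt0n fact_gt0.
- rewrite (gap_sum_telescope R _ (harmonic_number R))// => k.
  by rewrite /harmonic_number (big_nat_recr k.+1)//= addrAC subrr add0r.
Qed.
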